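(* Let $v,k$ be integers with $2 \le k < v$, let $S_1,\ldots,S_B$ be all the blocks of size $k$ in $v$ treatments that contain at least two distinct treatments, and let $V_1,\ldots,V_B$ and $M(p)=\sum_{j=1}^B p_j V_j$ be the $(v-1)\times(v-1)$ matrices defined in the context. A design measure $p=(p_1,\ldots,p_B)$ is A-optimal if and only if $M(p)$ is nonsingular and $$\operatorname{tr}\left[\{M(p)\}^{-1}V_j\{M(p)\}^{-1}\right] \le \operatorname{tr}\left[\{M(p)\}^{-1}\right] \quad \text{for all } 1\le j\le B.$$
   Context: There are $v$ ordered treatments $1,\ldots,v$ and the block size is $k$ with $k<v$. A block of size $k$ is a multiset of $k$ treatments (a treatment may appear more than once; such blocks are called nonbinary). Let $\mathcal{B}=\{S_1,\ldots,S_B\}$ be the class of all possible blocks of size $k$, excluding those which include only one (distinct) treatment. For $1\le j\le B$, let $h_{ij}$ be the number of times treatment $i$ appears in $S_j$, so the $h_{ij}$ are nonnegative integers with $h_{1j}+\cdots+h_{vj}=k$. Put $h_j=(h_{1j},\ldots,h_{vj})'$, $H_j=\operatorname{diag}(h_{1j},\ldots,h_{vj})$ and $C_j=H_j-k^{-1}h_jh_j'$, where the prime denotes transposition. Let $L$ be the $(v-1)\times v$ real matrix representing the treatment contrasts $\tau_i-\tau_{i-1}$, $2\le i\le v$; that is, for $\tau=(\tau_1,\ldots,\tau_v)'$, the vector $L\tau$ has entries $\tau_2-\tau_1,\ldots,\tau_v-\tau_{v-1}$. $L$ has full row rank. Put $T=(LL')^{-1}L$ and $V_j=TC_jT'$ for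 $1\le j\le B$. A design measure is a vector $p=(p_1,\ldots,p_B)$ of nonnegative real numbers with $p_1+\cdots+p_B=1$. For a design measure $p$, $M(p)=\sum_{j=1}^B p_jV_j$. A design measure is A-optimal if $M(p)$ is nonsingular for it and it minimizes $\operatorname{tr}[\{M(p)\}^{-1}]$ over all design measures $p$ such that $M(p)$ is nonsingular. *)

(* Defs.v *)
From HB Require Import structures.
From mathcomp Require Import all_boot all_order all_algebra.
From mathcomp Require Import reals.

Set Implicit Arguments.
Unset Strict Implicit.
Unset Printing Implicit Defensive.

Import Order.TTheory GRing.Theory Num.Theory.
Local Open Scope ring_scope.

(* A block is encoded by its multiplicity function [h], so that a multiset is  *)
(* counted once.  Multiplicities never exceed [k], hence the codomain.         *)
Definition is_block (v k : nat) (h : {ffun 'I_v -> 'I_k.+1}) : bool :=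
  (\sum_(i < v) (h i : nat) == k)%N && (1 < #|[set i | (0 < h i)%N]|)%N.

(* This finite type is also the index set 1, ..., B. *)
Definition block (v k : nat) : finType := {h : {ffun 'I_v -> 'I_k.+1} | is_block h}.

Definition mult (v k : nat) (S : block v k) (i : 'I_v) : nat := val S i.

Section Matrices.
Variables (R : realType) (v k : nat).
Implicit Types (S : block v k) (p : {ffun block v k -> R}).

Definition hvec S : 'cV[R]_v := \col_i (mult S i)%:R.

Definition Hmx S : 'M[R]_v := diag_mx (hvec S)^T.

Definition Cmx S : 'M[R]_v := Hmx S - k%:R^-1 *: (hvec S *m (hvec S)^T).

(* Treatments and contrasts are numbered from 0: row [i] is the contrast      *)
(* tau_(i+1) - tau_i.                                                         *)
Definition Lmx : 'M[R]_(v.-1, v) :=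
  \matrix_(i < v.-1, j < v) ((j == i.+1 :> nat)%:R - (j == i :> nat)%:R).

Definition Tmx : 'M[R]_(v.-1, v) := invmx (Lmx *m Lmx^T) *m Lmx.

Definition Vmx S : 'M[R]_(v.-1) := Tmx *m Cmx S *m Tmx^T.

Definition design_measure p : Prop :=
  (forall S, 0 <= p S) /\ \sum_S p S = 1.

Definition Mmx p : 'M[R]_(v.-1) := \sum_S p S *: Vmx S.

Definition A_optimal p : Prop :=
  [/\ design_measure p, Mmx p \in unitmx &
      forall q : {ffun block v k -> R}, design_measure q ->
        Mmx q \in unitmx -> \tr (invmx (Mmx p)) <= \tr (invmx (Mmx q))].

End Matrices.

(* Main.v *)
Require Import Defs.
From HB Require Import structures.
From mathcomp Require Import all_boot all_order all_algebra.
From mathcomp Require Import reals.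
From mathcomp Require Import ring lra.

Set Implicit Arguments.
Unset Strict Implicit.
Unset Printing Implicit Defensive.

Import Order.TTheory GRing.Theory Num.Theory.
Local Open Scope ring_scope.

(** Every [Vmx S] is positive semidefinite, and [M |-> tr M^-1] is convex on
    the positive definite matrices, so a first-order condition is both necessary
    and sufficient for a minimum: no directional derivative of the criterion at
    [M = M(p)] towards a vertex [V_j] of the simplex may be negative.  The
    derivative at [M] in the direction [D = V_j - M] is
    [- tr (M^-1 D M^-1) = tr M^-1 - tr (M^-1 V_j M^-1)], whence the inequality
    of the theorem.

    No differentiation is needed, because the distance from [N^-1] to the
    tangent of the inverse at [M] is known exactly ([tangent_gap]):
    [N^-1 - (2 M^-1 - M^-1 N M^-1) = M^-1 (N - M) N^-1 (N - M) M^-1].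

    Sufficiency uses only the sign of the right-hand side: for [N = M(q)] it
    gives [tr N^-1 >= 2 tr M^-1 - tr (M^-1 N M^-1)], and averaging the
    hypothesis over the weights [q_j] bounds the last trace by [tr M^-1].

    Necessity uses its size.  For [N = (1 - t) M + t V_j] one has
    [N - M = t D], so the right-hand side is [t^2 M^-1 D N^-1 D M^-1], and for
    [t <= 1/2] the inequality [N >= M / 2] gives [N^-1 <= 2 M^-1]
    ([invmx_antitone]).  Minimality of [tr M^-1] then yields
    [tr (M^-1 D M^-1) <= t c] with [c] independent of [t], and letting [t]
    tend to [0] finishes the proof ([tr_invmx_min_direction]). *)

(** * Positive semidefinite matrices *)

(** Symmetry is required separately: over a real field it does not follow from
    the sign of the quadratic form. *)
Definition psd (R : realFieldType) (n : nat) (A : 'M[R]_n) : Prop :=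
  A^T = A /\ forall x : 'rV[R]_n, 0 <= (x *m A *m x^T) 0 0.

Section PositiveSemidefinite.
Variables (R : realFieldType) (n : nat).
Implicit Types A B M N V : 'M[R]_n.

Lemma psdD A B : psd A -> psd B -> psd (A + B).
Proof.
move=> [sA pA] [sB pB]; split; first by rewrite linearD /= sA sB.
by move=> x; rewrite mulmxDr mulmxDl mxE addr_ge0.
Qed.

Lemma psdZ (a : R) A : 0 <= a -> psd A -> psd (a *: A).
Proof.
move=> a0 [sA pA]; split; first by rewrite linearZ /= sA.
by move=> x; rewrite -scalemxAr -scalemxAl mxE mulr_ge0.
Qed.

Lemma psd0 : psd (0 : 'M[R]_n).
Proof. by split=> [|x]; rewrite ?trmx0 // mulmx0 mul0mx mxE. Qed.

Lemma psd_sum (I : finType) (F : I -> 'M[R]_n) :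
  (forall i, psd (F i)) -> psd (\sum_i F i).
Proof. by move=> pF; elim/big_ind: _ => //; [exact: psd0 | exact: psdD]. Qed.

Lemma psd_trace_ge0 A : psd A -> 0 <= \tr A.
Proof.
move=> [_ pA]; apply: sumr_ge0 => i _.
by have := pA (delta_mx 0 i); rewrite -rowE trmx_delta -colE !mxE.
Qed.

(** If [x A x^T = 0], then [x] minimizes the quadratic form, so its gradient
    [x A] vanishes there.  Concretely, evaluating the form at [x + s (x A)] gives
    [2 s |x A|^2 + O(s^2)], which is negative for a suitable [s < 0] unless
    [x A = 0]. *)
Lemma psd_kernel A (x : 'rV[R]_n) :
  psd A -> (x *m A *m x^T) 0 0 = 0 -> x *m A = 0.
Proof.
move=> [sA pA] x0; set y := x *m A.
pose a : R := (y *m y^T) 0 0; pose b : R := (y *m A *m y^T) 0 0.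
have b0 : 0 <= b by exact: pA.
have form s : ((x + s *: y) *m A *m (x + s *: y)^T) 0 0 = (s * a) *+ 2 + s ^+ 2 * b.
  have yAx : y *m A *m x^T = y *m y^T by rewrite /y trmx_mul sA !mulmxA.
  rewrite linearD linearZ /= !mulmxDl !mulmxDr -!scalemxAl -!scalemxAr yAx -/y.
  have entryD (B C : 'M[R]_1) : (B + C) 0 0 = B 0 0 + C 0 0 by rewrite mxE.
  have entryZ c (B : 'M[R]_1) : (c *: B) 0 0 = c * B 0 0 by rewrite mxE.
  by rewrite !(entryD, entryZ) x0 -/a -/b; ring.
have a_ge0 : 0 <= a.
  by rewrite /a mxE sumr_ge0 // => i _; rewrite !mxE -expr2 sqr_ge0.
have a_le0 : a <= 0.
  have b1 : 0 < b + 1 by lra.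
  have := pA (x + (- (a / (b + 1))) *: y); rewrite form.
  set s := a / (b + 1); have sa : a = s * (b + 1) by rewrite /s divfK // gt_eqF.
  (* The form takes the value [- s^2 (b + 2)] at [x - s y]. *)
  rewrite sa => h; have s0 : s ^+ 2 * (b + 2) <= 0 by lra.
  have s2 : s ^+ 2 <= 0 by rewrite -(pmulr_lle0 _ (_ : 0 < b + 2)) //; lra.
  have /eqP-> : s == 0 by rewrite -sqrf_eq0 eq_le s2 sqr_ge0.
  by rewrite mul0r.
have {a_ge0 a_le0} : a = 0 by apply/eqP; rewrite eq_le a_le0.
rewrite /a mxE => /eqP; rewrite psumr_eq0 => [/allP y0|i _]; last first.
  by rewrite !mxE -expr2 sqr_ge0.
apply/rowP => i; have := y0 i (mem_index_enum i).
by rewrite !mxE -expr2 sqrf_eq0 => /eqP.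
Qed.

(** A vector in the kernel of [M + A] annihilates both quadratic forms, hence
    lies in the kernel of [M]. *)
Lemma psd_addl_unitmx M A : M \in unitmx -> psd M -> psd A -> M + A \in unitmx.
Proof.
move=> uM pM pA; rewrite -row_free_unit -kermx_eq0; apply/eqP/row_matrixP => i.
rewrite row0; set x := row i _.
have xMA : x *m (M + A) = 0 by apply/sub_kermxP/row_sub.
have xM : x *m M = 0.
  apply: psd_kernel => //; apply/eqP; rewrite eq_le pM.2 andbT.
  have : (x *m (M + A) *m x^T) 0 0 = 0 by rewrite xMA mul0mx mxE.
  by rewrite mulmxDr mulmxDl mxE => <-; rewrite lerDl pA.2.
by rewrite -(mulmxK uM x) xM mul0mx.
Qed.

Lemma psd_congr m (X : 'M[R]_(m, n)) A : psd A -> psd (X *m A *m X^T).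
Proof.
move=> [sA pA]; split; first by rewrite !trmx_mul trmxK sA mulmxA.
by move=> x; have := pA (x *m X); rewrite trmx_mul !mulmxA.
Qed.

Lemma psd_invmx N : N \in unitmx -> psd N -> psd (invmx N).
Proof.
move=> uN pN; have := psd_congr (invmx N) pN.
by rewrite mulVmx // mul1mx trmx_inv pN.1.
Qed.

(** * The inverse and its trace *)

(** Both sides equal [(N^-1 - M^-1) N (N^-1 - M^-1)]. *)
Lemma tangent_gap M N : M \in unitmx -> N \in unitmx ->
  invmx N - invmx M *+ 2 + invmx M *m N *m invmx M =
  invmx M *m (N - M) *m invmx N *m (N - M) *m invmx M.
Proof.
move=> uM uN; rewrite -[RHS]mulmxA mulmxBr mulVmx // mulmxBl mulmxK // mul1mx.
rewrite [(N - M) *m _]mulmxBl mulmxV // [RHS]mulmxBr mulmx1 mulmxBl mulKmx //.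
by rewrite mulmxA opprB [RHS]addrC mulr2n opprD !addrA [RHS]addrAC.
Qed.

Lemma tangent_gap_psd M N : M^T = M -> M \in unitmx -> psd N -> N \in unitmx ->
  psd (invmx N - invmx M *+ 2 + invmx M *m N *m invmx M).
Proof.
move=> sM uM pN uN; rewrite tangent_gap // -mulmxA.
have -> : (N - M) *m invmx M = (invmx M *m (N - M))^T.
  by rewrite trmx_mul trmx_inv linearB /= sM pN.1.
by apply/psd_congr/psd_invmx.
Qed.

(** The inverse lies above its tangent at [B], and that tangent evaluated at
    [A] is [B^-1 + B^-1 (B - A) B^-1], which is above [B^-1]. *)
Lemma invmx_antitone A B : psd A -> A \in unitmx -> B^T = B -> B \in unitmx ->
  psd (B - A) -> psd (invmx A - invmx B).
Proof.
move=> pA uA sB uB pBA.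
have := psdD (tangent_gap_psd sB uB pA uA) (psd_congr (invmx B) pBA).
rewrite trmx_inv sB mulmxBr mulVmx // mulmxBl mul1mx.
by rewrite addrACA subrr addr0 mulr2n opprD addrA subrK.
Qed.

(** The proof bounds the directional derivative [- tr (M^-1 D M^-1)], where
    [D = V - M], from below by [- t c] for every small [t], with the constant
    [c = tr (2 M^-1 D M^-1 D M^-1)]. *)
Lemma tr_invmx_min_direction M V : psd M -> M \in unitmx -> psd V ->
    (forall t : R, 0 < t < 1 -> (1 - t) *: M + t *: V \in unitmx ->
       \tr (invmx M) <= \tr (invmx ((1 - t) *: M + t *: V))) ->
  \tr (invmx M *m V *m invmx M) <= \tr (invmx M).
Proof.
move=> pM uM pV minM; pose X := invmx M *m (V - M).
have tX : X^T = (V - M) *m invmx M.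
  by rewrite /X trmx_mul trmx_inv linearB /= pM.1 pV.1.
pose c := \tr (X *m (2 *: invmx M) *m X^T).
have small (t : R) : 0 < t <= 1 / 2 ->
    \tr (invmx M *m V *m invmx M) - \tr (invmx M) <= t * c.
  move=> /andP[t0 t2]; set N : 'M[R]_n := (1 - t) *: M + t *: V.
  have uhM : 2^-1 *: M \in unitmx by rewrite unitmxZ // unitfE invr_eq0 pnatr_eq0.
  have pNM : psd (N - 2^-1 *: M).
    have -> : N - 2^-1 *: M = (1 - t - 2^-1) *: M + t *: V.
      by rewrite /N [in RHS]scalerBl addrAC.
    by apply: psdD; apply: psdZ => //; lra.
  have phM : psd (2^-1 *: M) by apply: psdZ => //; lra.
  have pN : psd N by rewrite -[N](subrK (2^-1 *: M)); apply: psdD.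
  have uN : N \in unitmx.
    by rewrite -[N](subrK (2^-1 *: M)) addrC psd_addl_unitmx.
  (* Now [N >= M / 2], so [N^-1 <= 2 M^-1] and the second-order term of
     [tr N^-1] is at most [t^2 c]. *)
  have NM : N - M = t *: (V - M).
    by rewrite /N scalerBl scale1r scalerBr [LHS]addrC !addrA addNr add0r addrC.
  have /psd_trace_ge0 := psd_congr X (invmx_antitone phM uhM pN.1 uN pNM).
  rewrite invmxZ // invrK mulmxBr mulmxBl linearB /= subr_ge0 -/c => leQ.
  have t1 : 0 < t < 1 by lra.
  have leMN := minM t t1 uN; rewrite -/N in leMN.
  have := congr1 mxtrace (tangent_gap uM uN).
  have -> : invmx M *m N *m invmx M =
      invmx M + t *: (invmx M *m V *m invmx M - invmx M).
    rewrite -[N](subrK M) NM mulmxDr mulmxDl mulVmx // mul1mx addrC; congr (_ + _).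
    by rewrite -scalemxAr -scalemxAl mulmxBr mulmxBl mulVmx // mul1mx.
  rewrite NM -!scalemxAr -!scalemxAl -[in RHS]mulmxA -tX -/X.
  rewrite !(mxtraceD, mxtraceZ) !raddfN /= raddfMn /=.
  set a := \tr (invmx N) in leMN *; set b := \tr (invmx M) in leMN *.
  set d := \tr (_ *m V *m _); set e := \tr _ in leQ *.
  move=> eqn; rewrite -(ler_pM2l t0).
  have : t * (t * e) <= t * (t * c) by rewrite !ler_pM2l.
  lra.
(* If the difference were some [x > 0], the choice [t = x / (2 (|c| + x))] would
   give [t c <= x / 2 < x]. *)
rewrite -subr_le0 leNgt; apply/negP; set x := _ - _ in small * => x0.
have c0 := normr_ge0 c; have cx : 0 < 2 * (`|c| + x) by lra.
have := small (x / (2 * (`|c| + x))).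
have -> : 0 < x / (2 * (`|c| + x)) <= 1 / 2.
  by rewrite divr_gt0 //= ler_pdivrMr //; lra.
move=> /(_ isT); rewrite mulrAC ler_pdivlMr // ler_pM2l //.
by have := ler_norm c; lra.
Qed.

End PositiveSemidefinite.

(** * Design measures *)

(** The quadratic form of [Cmx S] is the within-block sum of squares: with [m] the
    mean of [x] over the [k] plots, it equals [\sum_i h_i (x_i - m)^2]. *)
Lemma Cmx_psd (R : realType) (v k : nat) (S : block v k) :
  (0 < k)%N -> psd (Cmx R S).
Proof.
move=> k0; split.
  by rewrite /Cmx linearB linearZ /= trmx_mul trmxK /Hmx tr_diag_mx.
move=> x; have kR : k%:R != 0 :> R by rewrite pnatr_eq0 -lt0n.
pose h i : R := (mult S i)%:R; pose s := \sum_i x 0 i * h i.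
have sum_h : \sum_i h i = k%:R.
  by have /andP[/eqP sumS _] := valP S; rewrite -[in RHS]sumS natr_sum.
have xh : x *m hvec R S = s%:M.
  by apply/matrixP => i j; rewrite !ord1 !mxE mulr1n; apply: eq_bigr => l _; rewrite mxE.
rewrite /Cmx mulmxBr mulmxBl -scalemxAr -scalemxAl mulmxA xh -(mulmxA s%:M) -trmx_mul xh.
rewrite tr_scalar_mx -scalar_mxM.
suff -> : (x *m Hmx R S *m x^T - k%:R^-1 *: (s * s)%:M) 0 0 =
    \sum_i h i * (x 0 i - s / k%:R) ^+ 2.
  by apply: sumr_ge0 => i _; rewrite mulr_ge0 ?sqr_ge0 ?ler0n.
transitivity (\sum_i (h i * x 0 i ^+ 2 - (s / k%:R) *+ 2 * (x 0 i * h i)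
    + (s / k%:R) ^+ 2 * h i)); last by apply: eq_bigr => i _; ring.
rewrite big_split sumrB /= -!mulr_sumr sum_h -/s !mxE mulr1n.
have -> : \sum_j (x *m Hmx R S) 0 j * x^T j 0 = \sum_i h i * x 0 i ^+ 2.
  by apply: eq_bigr => j _; rewrite mul_mx_diag !mxE -/(h j); ring.
by field.
Qed.

Lemma Vmx_psd (R : realType) (v k : nat) (S : block v k) :
  (0 < k)%N -> psd (Vmx R S).
Proof. by move=> k0; apply/psd_congr/Cmx_psd. Qed.

Lemma Mmx_psd (R : realType) (v k : nat) (p : {ffun block v k -> R}) :
  (0 < k)%N -> design_measure p -> psd (Mmx p).
Proof.
by move=> k0 [p0 _]; apply: psd_sum => S; apply: psdZ => //; apply: Vmx_psd.
Qed.

Definition mix (R : realType) (v k : nat) (p : {ffun block v k -> R}) (t : R)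
    (j : block v k) : {ffun block v k -> R} :=
  [ffun S => (1 - t) * p S + t * (S == j)%:R].

Lemma mix_design_measure (R : realType) (v k : nat) (p : {ffun block v k -> R})
    (t : R) (j : block v k) :
  0 < t < 1 -> design_measure p -> design_measure (mix p t j).
Proof.
move=> /andP[t0 t1] [p0 p1]; split.
  by move=> S; rewrite ffunE addr_ge0 ?mulr_ge0 ?ler0n //; lra.
under eq_bigr do rewrite ffunE.
rewrite big_split /= -!mulr_sumr p1 (bigD1 j) //= eqxx big1 => [|S /negPf->//].
by rewrite addr0 !mulr1 subrK.
Qed.

Lemma Mmx_mix (R : realType) (v k : nat) (p : {ffun block v k -> R})
    (t : R) (j : block v k) :
  Mmx (mix p t j) = (1 - t) *: Mmx p + t *: Vmx R j.
Proof.
rewrite /Mmx; under eq_bigr do rewrite ffunE scalerDl -!scalerA.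
rewrite big_split /= -!scaler_sumr; congr (_ + _ *: _).
by rewrite (bigD1 j) //= eqxx scale1r big1 ?addr0 // => S /negPf->; rewrite scale0r.
Qed.

Theorem lemma1 (R : realType) (v k : nat) (hk : (2 <= k)%N) (hkv : (k < v)%N)
    (p : {ffun block v k -> R}) (hp : design_measure p) :
  A_optimal p <->
  Mmx p \in unitmx /\
  (forall j : block v k,
     \tr (invmx (Mmx p) *m Vmx R j *m invmx (Mmx p)) <= \tr (invmx (Mmx p))).
Proof.
have k0 : (0 < k)%N by exact: ltnW.
have pM := Mmx_psd k0 hp.
split=> [[_ uM minM]|[uM dirM]].
  split=> // j; apply: tr_invmx_min_direction => //; first exact: Vmx_psd.
  move=> t t01; rewrite -Mmx_mix; apply: minM; exact: mix_design_measure.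
split=> // q hq uN.
(* [M(q)] is the [q]-average of the [V_j], so the hypothesis controls the
   tangent at [M(p)] evaluated at [M(q)]. *)
have := psd_trace_ge0 (tangent_gap_psd pM.1 uM (Mmx_psd k0 hq) uN).
rewrite !mxtraceD raddfN /= raddfMn /=.
suff : \tr (invmx (Mmx p) *m Mmx q *m invmx (Mmx p)) <= \tr (invmx (Mmx p)) by lra.
rewrite {2}/Mmx mulmx_sumr mulmx_suml linear_sum /=.
rewrite -[leRHS]mul1r -hq.2 mulr_suml; apply: ler_sum => S _.
by rewrite -scalemxAr -scalemxAl linearZ /= ler_wpM2l // hq.1.
Qed.
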